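(* Fix an integer $n\ge 1$. For an integer $k$ with $-n\le k\le n$ put $r_{\min}^{(k)}=\left\lceil \frac{n+k}{2}\right\rceil$ and $r_{\max}^{(k)}=\min(n,n+k)$, and for $r_{\min}^{(k)}\le r\le r_{\max}^{(k)}$ define $$Q_{k,r}=\sum_{i=k+n-r}^{r}(-1)^i\binom{i-k+1}{n-r+1}\binom{n-i}{n-r}\,u_i\,u_{n+k-i}.$$ Then $Q_{k,r}$ is a nonzero element of $\mathcal Q_k$ of order $r$ (it involves $u_r$ but no $u_j$ with $j>r$), and it has deficiency $$m(k,r)=k+2\left(r-r_{\min}^{(k)}\right)$$ relative to $\mathcal P_n$, i.e. $Q_{k,r}(\mathcal P_n)\subset\mathcal P_{n-m(k,r)}$ but $Q_{k,r}(\mathcal P_n)\not\subset\mathcal P_{n-m(k,r)-1}$. Moreover $\{Q_{k,r}: r_{\min}^{(k)}\le r\le r_{\max}^{(k)}\}$ is a basis of $\mathcal Q_k$.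
   Context: Non-linear operators are identified with polynomial functions of jet variables: an element $P(x,u_0,\dots,u_n)\in\mathbb R[x,u_0,\dots,u_n]$ acts on a smooth function $f$ of one real variable by $P[f](x)=P(x,f(x),f'(x),\dots,f^{(n)}(x))$. For $s\ge 0$, $\mathcal P_s$ is the space of real polynomials in $x$ of degree at most $s$, and $\mathcal P_s=\{0\}$ for $s<0$. An operator $T$ has deficiency $m\in\mathbb Z$ relative to $\mathcal P_n$ if $T(\mathcal P_n)\subset\mathcal P_{n-m}$ but $T(\mathcal P_n)\not\subset\mathcal P_{n-m-1}$. For $-n\le k\le n$, $\mathcal Q_k$ is the real span of the monomials $u_iu_j$ with $i+j=n+k$, $0\le i,j\le n$ (the quadratic autonomous operators of ''monomial deficiency'' $k$). Binomial coefficients are $\binom{a}{i}=a(a-1)\cdots(a-i+1)/i!$ for $i\ge0$ and $0$ for $i<0$. *)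

(* Defs.v *)
From HB Require Import structures.
From mathcomp Require Import all_boot all_order all_algebra.
From mathcomp Require Import mpoly.
Set Implicit Arguments. Unset Strict Implicit. Unset Printing Implicit Defensive.
Import Order.TTheory GRing.Theory Num.Theory.
Local Open Scope ring_scope.

(* The jet ring R[x,u_0,...,u_n] is {mpoly R[n.+2]}: variable 0 is x,
   variable j.+1 is u_j. *)
Definition jetring (R : realFieldType) (n : nat) := {mpoly R[n.+2]}.

Definition uvar (R : realFieldType) (n : nat) (i : nat) : {mpoly R[n.+2]} :=
  'X_(inord i.+1).

Definition jet (R : realFieldType) (n : nat) (f : {poly R}) (j : 'I_n.+2) : {poly R} :=
  if (j == 0 :> nat) then 'X else f^`(j.-1).

Definition act (R : realFieldType) (n : nat) (P : {mpoly R[n.+2]}) (f : {poly R}) : {poly R} :=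
  (map_mpoly (@polyC R) P).@[@jet R n f].

Definition inPs (R : realFieldType) (s : int) (p : {poly R}) : Prop :=
  ((size p)%:Z <= s + 1)%R.

Definition has_deficiency (R : realFieldType) (n : nat) (T : {mpoly R[n.+2]}) (m : int) : Prop :=
  (forall f : {poly R}, (size f <= n.+1)%N -> inPs (n%:Z - m) (act T f)) /\
  ~ (forall f : {poly R}, (size f <= n.+1)%N -> inPs (n%:Z - m - 1) (act T f)).

Definition binz (R : realFieldType) (a : int) (i : nat) : R :=
  (\prod_(j < i) (a - j%:Z)%:~R) / (i`!)%:R.

Definition in_Qk (R : realFieldType) (n : nat) (k : int) (P : {mpoly R[n.+2]}) : Prop :=
  let N := (absz (n%:Z + k)) in
  exists c : nat -> R,
    P = \sum_(i < N.+1 | (i <= n)%N && (N - i <= n)%N) c i *: (uvar R n i * uvar R n (N - i)).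

Definition involves (R : realFieldType) (n : nat) (P : {mpoly R[n.+2]}) (j : nat) : Prop :=
  exists2 m, m \in msupp P & (0 < m (inord j.+1 : 'I_n.+2))%N.

Definition has_order (R : realFieldType) (n : nat) (P : {mpoly R[n.+2]}) (r : nat) : Prop :=
  involves P r /\ forall j, (r < j <= n)%N -> ~ involves P j.

Definition rmin (n : nat) (k : int) : nat := uphalf (absz (n%:Z + k)).
Definition rmax (n : nat) (k : int) : nat := minn n (absz (n%:Z + k)).

Definition Qkr (R : realFieldType) (n : nat) (k : int) (r : nat) : {mpoly R[n.+2]} :=
  let N := (absz (n%:Z + k)) in
  \sum_(N - r <= i < r.+1)
     ((-1) ^+ i * binz R (i%:Z - k + 1) (n - r + 1) * binz R (n%:Z - i%:Z) (n - r))
       *: (uvar R n i * uvar R n (N - i)).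

Definition is_basis (R : realFieldType) (n : nat) (S : {mpoly R[n.+2]} -> Prop)
    (b : nat -> {mpoly R[n.+2]}) (lo hi : nat) : Prop :=
  [/\ forall r, (lo <= r <= hi)%N -> S (b r),
      forall c : nat -> R, \sum_(lo <= r < hi.+1) c r *: b r = 0 ->
                           forall r, (lo <= r <= hi)%N -> c r = 0
    & forall P, S P -> exists c : nat -> R, P = \sum_(lo <= r < hi.+1) c r *: b r].

(* Main.v *)
Require Import Defs.
From HB Require Import structures.
From mathcomp Require Import all_boot all_order all_algebra.
From mathcomp Require Import mpoly.
From mathcomp Require Import zify ring.
Set Implicit Arguments. Unset Strict Implicit. Unset Printing Implicit Defensive.
Import Order.TTheory GRing.Theory Num.Theory.
Local Open Scope ring_scope.

(** Put N = n + k and s = n - r.  The coefficient of u_i u_(N-i) in Q_(k,r) is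
    (-1)^i W(i), with W a polynomial of degree 2s + 1 in i vanishing whenever
    one of i, N - i lies in ]r, n].  On the pair of monomials x^p, x^q the
    bilinear form polarising Q_(k,r) yields x^t, t = p + q - N, with coefficient
    sum_i (-1)^i W(i) p! q! / ((p - i)! (q - N + i)!), which is, up to a nonzero
    factor, the t-th finite difference of W: it vanishes for t > deg W, and for
    t = deg W it is a nonzero multiple of the leading coefficient.  When N is
    even, symmetrising under i <-> N - i replaces W by a polynomial of degree 2s.
    So the degree bound is 2s + (N mod 2) = n - m(k,r), attained at
    x^(s + r_min).  Collecting equal monomials, Q_(k,r) is a combination of the
    u_i u_(N-i) with r_min <= i <= r in which that of i = r has a nonzero
    coefficient; triangularity gives the order and the basis property. *)

(** * Alternating binomial sums and finite differences *)

Lemma alternating_binomial_sum (R : comNzRingType) (t : nat) :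
  \sum_(l < t.+1) (-1) ^+ l * ('C(t, l))%:R = (t == 0)%:R :> R.
Proof.
transitivity ((1 - 1 : R) ^+ t); last by rewrite subrr expr0n.
rewrite exprDn; apply: eq_bigr => l _.
by rewrite expr1n mul1r mulr_natr.
Qed.

(** Induction on [W = V * 'X + c]. Split [W.[a - l]] into [a * V], [c] and [- l * V]: the first part
    vanishes because [size V <= t], the second unless [t = 0], and the absorption identity for
    [l * 'C(t, l)] turns the third into a difference of [V] of order [t - 1] based at [a - 1]. *)
Lemma finite_difference (R : comNzRingType) (W : {poly R}) (t : nat) (a : R) :
  (size W <= t.+1)%N ->
  \sum_(l < t.+1) (-1) ^+ l * ('C(t, l))%:R * W.[a - l%:R] = t`!%:R * W`_t.
Proof.
elim/poly_ind: W t a => [|V c IH] t a sW.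
  by rewrite coef0 mulr0 big1 // => l _; rewrite horner0 mulr0.
have sV : (size V <= t)%N.
  by move: sW; rewrite size_MXaddC; case: ifP => // /andP[/eqP-> _]; rewrite size_poly0.
transitivity (a * (\sum_(l < t.+1) (-1) ^+ l * ('C(t, l))%:R * V.[a - l%:R])
  + (\sum_(l < t.+1) (-1) ^+ l * ('C(t, l))%:R * c
     - \sum_(l < t.+1) (-1) ^+ l * (l * 'C(t, l))%:R * V.[a - l%:R])).
  rewrite mulr_sumr -sumrB -big_split; apply: eq_bigr => l _ /=.
  by rewrite hornerMXaddC natrM; ring.
rewrite IH ?(leq_trans sV) // nth_default // !mulr0 add0r -mulr_suml.
rewrite alternating_binomial_sum coefD coefMX coefC.
case: t sW sV => [|t] sW sV /=.
  by rewrite big_ord_recl big_ord0 mul0n mulr0 mul0r addr0 subr0 add0r fact0.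
rewrite mul0r sub0r addr0 big_ord_recl mul0n mulr0 mul0r add0r.
rewrite -sumrN factS natrM -mulrA -(IH t (a - 1)) // mulr_sumr.
apply: eq_bigr => l _; rewrite lift0 -mul_bin_diag natrM exprS.
by rewrite -[l.+1%:R]nat1r opprD addrA /=; ring.
Qed.

(** * Falling factorials and the weight polynomials *)

Definition fall (R : pzRingType) (x : R) (s : nat) : R := \prod_(l < s) (x - l%:R).

Lemma fallS (R : pzRingType) (x : R) (s : nat) : fall (x + 1) s.+1 = (x + 1) * fall x s.
Proof.
rewrite /fall big_ord_recl subr0; congr (_ * _); apply: eq_bigr => l _.
by rewrite lift0 -natr1 opprD addrACA subrr addr0.
Qed.

Lemma fall_small (R : comNzRingType) (m s : nat) : (m < s)%N -> fall (m%:R : R) s = 0.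
Proof. by move=> lt_ms; rewrite /fall (bigD1 (Ordinal lt_ms)) //= subrr mul0r. Qed.

Lemma fall_neq0 (R : numDomainType) (m s : nat) : (s <= m)%N -> fall (m%:R : R) s != 0.
Proof.
move=> le_sm; apply/prodf_neq0 => l _.
by rewrite subr_eq0 eqr_nat neq_ltn (leq_trans (ltn_ord l) le_sm) orbT.
Qed.

Lemma binzE (R : realFieldType) (a : int) (s : nat) :
  binz R a s = fall (a%:~R : R) s / s`!%:R.
Proof. by congr (_ / _); apply: eq_bigr => l _; rewrite rmorphB. Qed.

Definition fall_poly (R : nzRingType) (b : R) (s : nat) : {poly R} :=
  \prod_(l < s) ('X - (b + l%:R)%:P).

Lemma horner_fall_poly (R : comNzRingType) (b x : R) (s : nat) :
  (fall_poly b s).[x] = fall (x - b) s.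
Proof.
rewrite horner_prod; apply: eq_bigr => l _.
by rewrite hornerXsubC opprD addrA.
Qed.

Lemma size_fall_poly (R : comNzRingType) (b : R) (s : nat) : size (fall_poly b s) = s.+1.
Proof. by rewrite /fall_poly size_prod_XsubC /index_enum -enumT size_enum_ord. Qed.

Lemma monic_fall_poly (R : comNzRingType) (b : R) (s : nat) : fall_poly b s \is monic.
Proof. exact: monic_prod_XsubC. Qed.

(** Reverse the order of the factors and negate each one. This rewrites [fall (n - x) s] as a signed
    monic polynomial in [x]. *)
Lemma fallN (R : comNzRingType) (x : R) (s : nat) :
  fall x s = (-1) ^+ s * fall (s%:R - 1 - x) s.
Proof.
rewrite /fall [in RHS](reindex_inj rev_ord_inj) /=.
rewrite -[in (-1) ^+ s](card_ord s) -prodrN; apply: eq_bigr => l _.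
rewrite natrB // -natr1; ring.
Qed.

(* At [x = i], [c = 1] gives the coefficients of [Qkr] up to sign and factorials,
   and [c = 0] those of its symmetrisation when [N] is even. *)
Definition weight_poly (R : nzRingType) (n N s c : nat) : {poly R} :=
  (-1) ^+ s *: (fall_poly (N%:R - n%:R - c%:R) (s + c) * fall_poly (n%:R - s%:R + 1) s).

Lemma horner_weight_poly (R : comNzRingType) (n N s c : nat) (x : R) :
  (weight_poly R n N s c).[x]
  = fall (x + n%:R - N%:R + c%:R) (s + c) * fall (n%:R - x) s.
Proof.
rewrite /weight_poly hornerZ hornerM !horner_fall_poly [fall (n%:R - x) s]fallN.
have -> : x - (N%:R - n%:R - c%:R) = x + n%:R - N%:R + c%:R by ring.
have -> : x - (n%:R - s%:R + 1) = s%:R - 1 - (n%:R - x) by ring.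
by ring.
Qed.

Lemma size_weight_poly (R : idomainType) (n N s c : nat) :
  size (weight_poly R n N s c) = (s + s + c).+1.
Proof.
rewrite /weight_poly size_scale ?signr_eq0 // size_monicM ?monic_fall_poly //.
  by rewrite !size_fall_poly; lia.
by rewrite -size_poly_gt0 size_fall_poly.
Qed.

(** The second factor is the falling factorial of length [n - r] of the smaller natural number
    [n - i]. *)
Lemma weight_poly_root (R : comNzRingType) (n N r c i : nat) :
  (r < i <= n)%N -> (weight_poly R n N (n - r) c).[i%:R] = 0.
Proof.
move=> /andP[lt_ri le_in]; rewrite horner_weight_poly -natrB //.
by rewrite [X in _ * X]fall_small ?mulr0 //; lia.
Qed.

(** At [N - j] the first factor has length [n - r + c] and starts from the smaller natural number
    [n - j + c]. *)
Lemma weight_poly_coroot (R : comNzRingType) (n N r c j : nat) :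
  (r < j <= n)%N -> (weight_poly R n N (n - r) c).[N%:R - j%:R] = 0.
Proof.
move=> /andP[lt_rj le_jn]; rewrite horner_weight_poly.
have -> : N%:R - j%:R + n%:R - N%:R + c%:R = (n - j + c)%:R :> R.
  by rewrite natrD natrB //; ring.
by rewrite fall_small ?mul0r //; lia.
Qed.

(** * The weighted sum attached to a pair of monomials *)

Lemma eq_big_nat_support (V : nmodType) (a b a' b' : nat) (F : nat -> V) :
  (forall i, ~~ (a <= i < b)%N -> F i = 0) ->
  (forall i, ~~ (a' <= i < b')%N -> F i = 0) ->
  \sum_(a <= i < b) F i = \sum_(a' <= i < b') F i.
Proof.
move=> F0 F0'.
have widen c d : (d <= maxn b b')%N -> (forall i, ~~ (c <= i < d)%N -> F i = 0) ->
    \sum_(c <= i < d) F i = \sum_(0 <= i < maxn b b') F i.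
  move=> le_d Fcd; rewrite (big_nat_widenl c 0) // (big_nat_widen _ _ _ _ _ le_d).
  rewrite big_mkcond; apply: eq_bigr => i _ /=.
  by case: ifPn => // /Fcd.
by rewrite !widen // ?leq_maxl ?leq_maxr.
Qed.

(** Put [i = p - l] and [t = p + q - N]: then [p ^_ i * q ^_ (N - i)] is [p! q! / (l! (t - l)!)], a
    multiple of ['C(t, l)]. The zeros of [W] reconcile the two summation ranges. *)
Lemma monomial_pair_sum (R : realFieldType) (n N r p q : nat) (W : {poly R}) :
  (forall i, (r < i <= n)%N -> W.[i%:R] = 0) ->
  (forall j, (r < j <= n)%N -> W.[N%:R - j%:R] = 0) ->
  (r <= N)%N -> (p <= n)%N -> (q <= n)%N -> (N <= p + q)%N ->
  \sum_(N - r <= i < r.+1) (-1) ^+ i * W.[i%:R] * (p ^_ i * q ^_ (N - i))%:R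
  = (-1) ^+ p * (p`! * q`!)%:R / ((p + q - N)`!)%:R *
    \sum_(l < (p + q - N).+1) (-1) ^+ l * ('C(p + q - N, l))%:R * W.[p%:R - l%:R].
Proof.
move=> W0 W0' le_rN le_pn le_qn le_Npq; set t := (p + q - N)%N.
pose F i := (-1) ^+ i * W.[i%:R] * (p ^_ i * q ^_ (N - i))%:R.
pose G l := (-1) ^+ l * ('C(t, l))%:R * W.[p%:R - l%:R].
(* Out of range, either a falling factorial vanishes ([i > p] or [N - i > q]), or [i] or [N - i]
   lies in []r, n]] and [W] vanishes. *)
have F0 i : ~~ (N - r <= i < r.+1)%N -> F i = 0.
  move=> out; rewrite /F; have [lt_pi|le_ip] := ltnP p i.
    by rewrite (ffact_small lt_pi) mul0n mulr0.
  have [lt_ri|le_ir] := ltnP r i; first by rewrite W0 ?mulr0 ?mul0r //; lia.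
  have [lt_qj|le_jq] := ltnP q (N - i)%N.
    by rewrite (ffact_small lt_qj) muln0 mulr0.
  have -> : (i%:R : R) = N%:R - (N - i)%:R by rewrite natrB; [ring | lia].
  by rewrite W0' ?mulr0 ?mul0r //; lia.
(* For [p < l <= t] the point [p - l] is negative, but equals [N - j] with [j = N + l - p] and
   [r < j <= q <= n], a zero of [W]. *)
have G0 l : (p < l)%N -> G l = 0.
  move=> lt_pl; have [lt_tl|le_lt] := ltnP t l.
    by rewrite /G bin_small // mulr0 mul0r.
  have -> : G l = (-1) ^+ l * ('C(t, l))%:R * W.[N%:R - (N + l - p)%:R].
    by rewrite /G natrB ?natrD; [congr (_ * W.[_]); ring | lia].
  by rewrite W0' ?mulr0 //; lia.
have EF : \sum_(N - r <= i < r.+1) F i = \sum_(l < p.+1) F (p - l)%N.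
  rewrite (eq_big_nat_support (a' := 0) (b' := p.+1) F0).
    by rewrite big_nat_rev /= big_mkord; apply: eq_bigr => l _; rewrite add0n subSS.
  by move=> i; rewrite -leqNgt => lt_pi; rewrite /F ffact_small // mul0n mulr0.
have EG : \sum_(l < t.+1) G l = \sum_(l < p.+1) G l.
  rewrite -!(big_mkord xpredT G); apply: eq_big_nat_support => l; rewrite -leqNgt.
    by move=> lt_tl; rewrite /G bin_small // mulr0 mul0r.
  exact: G0.
rewrite EF EG mulr_sumr; apply: eq_bigr => -[l /=]; rewrite ltnS => le_lp _.
rewrite /F /G -natrB //.
(* Here [N - (p - l)] truncates to 0 and kills nothing; [W] does, since [p - l > N >= r]. *)
have [lt_Ni|le_iN] := ltnP N (p - l)%N; first by rewrite W0 ?mulr0 ?mul0r //; lia.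
have [lt_tl|le_lt] := ltnP t l.
  by rewrite bin_small // (@ffact_small q) ?muln0 ?mulr0 ?mul0r ?mulr0 //; rewrite /t in lt_tl; lia.
have fct (m : nat) : (m`!%:R : R) != 0 by rewrite pnatr_eq0 -lt0n fact_gt0.
rewrite !natrM.
have -> : (p ^_ (p - l))%:R = p`!%:R / l`!%:R :> R.
  apply: (canRL (mulfK (fct _))); rewrite -natrM -{2}(subKn le_lp) ffact_fact //.
  exact: leq_subr.
have -> : (q ^_ (N - (p - l)))%:R = q`!%:R / (t - l)`!%:R :> R.
  apply: (canRL (mulfK (fct _))); rewrite -natrM.
  rewrite -[in RHS](@ffact_fact q (N - (p - l))) //; last by rewrite /t in le_lt; lia.
  by congr (_ * _`!)%:R; rewrite /t in le_lt *; lia.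
have -> : ('C(t, l))%:R = t`!%:R / (l`!%:R * (t - l)`!%:R) :> R.
  by apply: (canRL (mulfK _)); rewrite ?mulf_neq0 // -!natrM bin_fact.
have -> : (-1) ^+ p = (-1) ^+ (p - l) * (-1) ^+ l :> R by rewrite -exprD subnK.
have sgn : (-1) ^+ l * (-1) ^+ l = 1 :> R by rewrite -expr2 sqrr_sign.
move: sgn; move: ((-1) ^+ l) ((-1) ^+ (p - l)) W.[_] => a b w sgn.
move: (fct t) (fct l) (fct (t - l)%N).
move: (p`!%:R) (q`!%:R) (t`!%:R) (l`!%:R) ((t - l)`!%:R) => x y z u v z0 u0 v0.
by rewrite -[LHS]mulr1 -sgn; field; rewrite z0 u0 v0.
Qed.

Lemma monomial_pair_coef (R : realFieldType) (n N r p q : nat) (W : {poly R}) :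
  (forall i, (r < i <= n)%N -> W.[i%:R] = 0) ->
  (forall j, (r < j <= n)%N -> W.[N%:R - j%:R] = 0) ->
  (r <= N)%N -> (p <= n)%N -> (q <= n)%N -> (N <= p + q)%N ->
  (size W <= (p + q - N).+1)%N ->
  \sum_(N - r <= i < r.+1) (-1) ^+ i * W.[i%:R] * (p ^_ i * q ^_ (N - i))%:R
  = (-1) ^+ p * (p`! * q`!)%:R * W`_(p + q - N).
Proof.
move=> W0 W0' le_rN le_pn le_qn le_Npq sW.
rewrite (monomial_pair_sum W0 W0') // finite_difference //.
by rewrite mulrA divfK // pnatr_eq0 -lt0n fact_gt0.
Qed.

(** * The bilinear form and the degree of its values *)

(** Two arguments make the form bilinear, so that pairs of monomials determine it; the operator
    itself is its restriction to [f = g]. *)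
Definition quad_form (R : nzRingType) (N r : nat) (w : nat -> R) (f g : {poly R}) : {poly R} :=
  \sum_(N - r <= i < r.+1) w i *: (f^`(i) * g^`(N - i)).

Lemma derivn_pair_Xn (R : comNzRingType) (N p q i : nat) : (i <= N)%N ->
  ('X^p)^`(i) * ('X^q)^`(N - i) = (p ^_ i * q ^_ (N - i))%:R *: 'X^(p + q - N) :> {poly R}.
Proof.
move=> le_iN; rewrite !derivnXn mulrnAl mulrnAr -mulrnA -scaler_nat mulnC -exprD.
(* The truncated exponents add up to [p + q - N] only when [i <= p] and [N - i <= q]; otherwise the
   coefficient is zero. *)
have [lt_pi|le_ip] := ltnP p i; first by rewrite (ffact_small lt_pi) !mul0n !scale0r.
have [lt_qj|le_jq] := ltnP q (N - i)%N.
  by rewrite (ffact_small lt_qj) !muln0 !scale0r.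
by congr (_ *: 'X^ _); lia.
Qed.

Lemma quad_form_Xn (R : comNzRingType) (N r p q : nat) (w : nat -> R) : (r <= N)%N ->
  quad_form N r w 'X^p 'X^q
  = (\sum_(N - r <= i < r.+1) w i * (p ^_ i * q ^_ (N - i))%:R) *: 'X^(p + q - N).
Proof.
move=> le_rN; rewrite scaler_suml; apply: eq_big_nat => i i_r.
by rewrite derivn_pair_Xn ?scalerA //; lia.
Qed.

Lemma quad_formE (R : comNzRingType) (n N r : nat) (w : nat -> R) (f g : {poly R}) :
  (size f <= n.+1)%N -> (size g <= n.+1)%N ->
  quad_form N r w f g
  = \sum_(p < n.+1) \sum_(q < n.+1) (f`_p * g`_q) *: quad_form N r w 'X^p 'X^q.
Proof.
move=> sf sg.
have expand (h : {poly R}) i : (size h <= n.+1)%N ->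
    h^`(i) = \sum_(p < n.+1) h`_p *: ('X^p)^`(i).
  move=> sh; have {1}-> : h = \sum_(p < n.+1) h`_p *: 'X^p.
    rewrite -poly_def; apply/polyP => l; rewrite coef_poly.
    by case: ltnP => // /(leq_trans sh) /(nth_default 0).
  by rewrite linear_sum; apply: eq_bigr => p _; rewrite linearZ.
rewrite /quad_form.
under eq_bigr => i _ do rewrite (expand f) // (expand g) // mulr_suml scaler_sumr.
rewrite exchange_big; apply: eq_bigr => p _ /=.
under eq_bigr => i _ do rewrite mulr_sumr scaler_sumr.
rewrite exchange_big; apply: eq_bigr => q _ /=.
rewrite scaler_sumr; apply: eq_bigr => i _.
by rewrite -scalerAl -scalerAr !scalerA; congr (_ *: _); ring.
Qed.

(** A pair of monomials with [p + q - N > d] contributes a multiple of a coefficient of [W] beyond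
    its degree, hence nothing. Pairs with [p + q < N] fall under the trivial case, the subtraction
    being truncated. *)
Lemma size_quad_form (R : realFieldType) (n N r d : nat) (W : {poly R}) (f : {poly R}) :
  (forall i, (r < i <= n)%N -> W.[i%:R] = 0) ->
  (forall j, (r < j <= n)%N -> W.[N%:R - j%:R] = 0) ->
  (r <= N)%N -> (size f <= n.+1)%N -> (size W <= d.+1)%N ->
  (size (quad_form N r (fun i => (-1) ^+ i * W.[i%:R])%R f f) <= d.+1)%N.
Proof.
move=> W0 W0' le_rN sf sW; rewrite (quad_formE _ _ _ sf sf).
apply: (leq_trans (size_sum _ _ _)); apply/bigmax_leqP => p _.
apply: (leq_trans (size_sum _ _ _)); apply/bigmax_leqP => q _.
apply: (leq_trans (size_scale_leq _ _)); rewrite quad_form_Xn //.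
have := ltn_ord p; have := ltn_ord q; have [le_td|lt_dt] := leqP (p + q - N) d.
  by move=> _ _; apply: (leq_trans (size_scale_leq _ _)); rewrite size_polyXn.
move=> ltq ltp; rewrite (monomial_pair_coef W0 W0') //; [|lia..].
by rewrite nth_default ?mulr0 ?scale0r ?size_poly0 // (leq_trans sW).
Qed.

(** The bound is sharp: with [p + p - N = d] the coefficient is a nonzero multiple of the leading
    coefficient of [W]. *)
Lemma size_quad_form_Xn (R : realFieldType) (n N r p d : nat) (W : {poly R}) :
  (forall i, (r < i <= n)%N -> W.[i%:R] = 0) ->
  (forall j, (r < j <= n)%N -> W.[N%:R - j%:R] = 0) ->
  (r <= N)%N -> (p <= n)%N -> (p + p = N + d)%N -> size W = d.+1 ->
  size (quad_form N r (fun i => (-1) ^+ i * W.[i%:R]) 'X^p 'X^p) = d.+1.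
Proof.
move=> W0 W0' le_rN le_pn pd sW; have td : (p + p - N = d)%N by lia.
rewrite quad_form_Xn // (monomial_pair_coef W0 W0') ?td ?sW //; last by lia.
have Wd : W`_d != 0.
  by have := lead_coef_eq0 W; rewrite lead_coefE sW /= => ->; rewrite -size_poly_eq0 sW.
rewrite size_scale ?size_polyXn // mulf_neq0 // mulf_neq0 ?signr_eq0 //.
by rewrite pnatr_eq0 -lt0n muln_gt0 !fact_gt0.
Qed.

Lemma act_sum_uvar (R : realFieldType) (n N r : nat) (w : nat -> R) (f : {poly R}) :
  (r <= n)%N ->
  act (\sum_(N - r <= i < r.+1) w i *: (uvar R n i * uvar R n (N - i))) f
  = quad_form N r w f f.
Proof.
move=> le_rn; have actu i : (i <= n)%N -> act (uvar R n i) f = f^`(i).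
  by move=> le_in; rewrite /act /uvar map_mpolyX mevalXU /jet inordK.
rewrite /act /quad_form (raddf_sum (map_mpoly _)) raddf_sum /=; apply: eq_big_nat => i i_r.
rewrite map_mpolyZ mevalZ rmorphM mevalM -!/(act _ _) !actu ?mul_polyC //; lia.
Qed.

(** * The coefficients of the operators and their symmetrisation *)

(** The parameter is the natural number [N = n + k], which avoids the absolute value in [Qkr]. *)
Definition qcoef (R : realFieldType) (n N r i : nat) : R :=
  (-1) ^+ i * binz R (i%:Z - (N%:Z - n%:Z) + 1) (n - r + 1) * binz R (n%:Z - i%:Z) (n - r).

Lemma qcoefE (R : realFieldType) (n N r i : nat) :
  qcoef R n N r i = (-1) ^+ i * ((((n - r).+1)`! * (n - r)`!)%:R^-1
                                 * (weight_poly R n N (n - r) 1).[i%:R]).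
Proof.
have e1 : (i%:Z - (N%:Z - n%:Z) + 1)%:~R = i%:R + n%:R - N%:R + 1%:R :> R.
  by rewrite rmorphD !rmorphB /= !pmulrn; ring.
have e2 : (n%:Z - i%:Z)%:~R = n%:R - i%:R :> R by rewrite rmorphB /= !pmulrn.
by rewrite /qcoef !binzE horner_weight_poly e1 e2 !addn1 natrM invfM; ring.
Qed.

Lemma weight_poly1E (R : comNzRingType) (n N s : nat) (x : R) :
  (weight_poly R n N s 1).[x] = (x + n%:R - N%:R + 1) * (weight_poly R n N s 0).[x].
Proof. by rewrite !horner_weight_poly !addr0 addn0 addn1 fallS mulrA. Qed.

Lemma weight_poly0_rev (R : comNzRingType) (n N s : nat) (x : R) :
  (weight_poly R n N s 0).[N%:R - x] = (weight_poly R n N s 0).[x].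
Proof.
rewrite !horner_weight_poly !addr0 addn0 mulrC.
by congr (fall _ _ * fall _ _); ring.
Qed.

(** The weight with [c = 0] is symmetric, so only the linear factors [i + n - N + 1] and [n - i + 1]
    and the relative sign [(-1) ^+ N] matter. For even [N] the factors add up to a constant, which
    lowers the degree by one. *)
Lemma qcoefDrev (R : realFieldType) (n N r i : nat) : (i <= N)%N ->
  qcoef R n N r i + qcoef R n N r (N - i) =
  (-1) ^+ i * ((((n - r).+1)`! * (n - r)`!)%:R^-1
    * ((if odd N then i%:R *+ 2 - N%:R else n%:R *+ 2 + 2 - N%:R)
       * (weight_poly R n N (n - r) 0).[i%:R])).
Proof.
move=> le_iN; rewrite !qcoefE !weight_poly1E natrB // weight_poly0_rev.
have -> : (-1) ^+ (N - i) = (-1) ^+ odd N * (-1) ^+ i :> R.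
  by rewrite -signr_odd oddB // signr_addb !signr_odd.
by case: (odd N); rewrite ?expr0 ?expr1; ring.
Qed.

Lemma quad_form_sym (R : realFieldType) (N r : nat) (w : nat -> R) (f : {poly R}) :
  (r <= N)%N -> (N <= r + r)%N ->
  quad_form N r w f f = quad_form N r (fun i => (w i + w (N - i)%N) / 2) f f.
Proof.
move=> le_rN le_Nr.
have rev : quad_form N r w f f = quad_form N r (fun i => w (N - i)%N) f f.
  rewrite /quad_form big_nat_rev /=; apply: eq_big_nat => i i_r.
  have -> : (N - r + r.+1 - i.+1 = N - i)%N by lia.
  by rewrite subKn ?(mulrC f^`(i)) //; lia.
have two : (2 : R) != 0 by rewrite pnatr_eq0.
apply: (scalerI two); rewrite scaler_nat mulr2n {2}rev /quad_form -big_split scaler_sumr.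
apply: eq_bigr => i _ /=; rewrite -scalerDl scalerA; congr (_ *: _).
by rewrite mulrC divfK.
Qed.

Lemma quad_form_qcoef (R : realFieldType) (n N r : nat) :
  (r <= N)%N -> (N <= r + r)%N -> (r <= n)%N ->
  exists W : {poly R},
  [/\ size W = ((n - r) + (n - r) + odd N).+1,
      forall i, (r < i <= n)%N -> W.[i%:R] = 0,
      forall j, (r < j <= n)%N -> W.[N%:R - j%:R] = 0
    & forall f, quad_form N r (qcoef R n N r) f f
                = quad_form N r (fun i => (-1) ^+ i * W.[i%:R]) f f].
Proof.
move=> le_rN le_Nr le_rn; set s := (n - r)%N.
pose C : R := ((s.+1)`! * s`!)%:R^-1.
have C0 : C != 0 by rewrite invr_eq0 pnatr_eq0 -lt0n muln_gt0 !fact_gt0.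
(* The boolean [c] is the parity of [N] and also the extra degree of the weight. *)
have main (c : bool) (a : R) : a != 0 -> c = odd N ->
    (forall f, quad_form N r (qcoef R n N r) f f
       = quad_form N r (fun i => (-1) ^+ i * (a *: weight_poly R n N s c).[i%:R]) f f) ->
    exists W : {poly R},
      [/\ size W = (s + s + odd N).+1, forall i, (r < i <= n)%N -> W.[i%:R] = 0,
          forall j, (r < j <= n)%N -> W.[N%:R - j%:R] = 0
        & forall f, quad_form N r (qcoef R n N r) f f
                = quad_form N r (fun i => (-1) ^+ i * W.[i%:R]) f f].
  move=> a0 cN eqW; exists (a *: weight_poly R n N s c); split=> // [|i i_r|j j_r].
  - by rewrite size_scale // size_weight_poly cN.
  - by rewrite hornerZ weight_poly_root ?mulr0.
  - by rewrite hornerZ weight_poly_coroot ?mulr0.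
case oddN: (odd N) main => main.
  apply: (main true C) => // f; apply: eq_bigr => i _; congr (_ *: _).
  by rewrite qcoefE [in RHS]hornerZ.
(* The scalar is the constant of [qcoefDrev] halved by averaging; it is nonzero since
   [N <= r + r <= n + n]. *)
apply: (main false (C * (n%:R *+ 2 + 2 - N%:R) / 2)) => [|//|f].
  rewrite mulf_neq0 ?invr_eq0 ?pnatr_eq0 // mulf_neq0 // subr_eq0 -mulrnA -natrD eqr_nat.
  by apply/eqP; lia.
rewrite quad_form_sym //; apply: eq_big_nat => i i_r; congr (_ *: _).
rewrite qcoefDrev; last by lia.
by rewrite oddN [in RHS]hornerZ -/s -/C; ring.
Qed.

(** * Collecting equal monomials; triangular families *)

(** Induction on [r - uphalf N]: each step adds the outer indices [r] and [N - r], which carry the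
    same vector. At the centre there are two indices for odd [N], and one, not to be doubled, for
    even [N]. *)
Lemma sum_fold_sym (R : pzRingType) (V : lmodType R) (E : nat -> V) (N r : nat) (c : nat -> R) :
  (forall i, (i <= N)%N -> E (N - i)%N = E i) -> (uphalf N <= r <= N)%N ->
  \sum_(N - r <= i < r.+1) c i *: E i
  = \sum_(uphalf N <= i < r.+1)
      (if (i + i == N)%N then c i else c i + c (N - i)%N) *: E i.
Proof.
move=> symE /andP[/subnKC <-]; elim: (r - uphalf N)%N => [|m IH] le_rN.
  have [oddN|evenN] := boolP (odd N); rewrite addn0 in le_rN *.
    have hN : (uphalf N + uphalf N = N.+1)%N by rewrite uphalfE; lia.
    rewrite big_ltn; last by lia.
    have -> : (N - uphalf N).+1 = uphalf N by lia.
    rewrite !big_nat1; case: eqP => [|_]; first by lia.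
    by rewrite symE // -scalerDl addrC.
  have hN : (uphalf N + uphalf N = N)%N by rewrite uphalfE; lia.
  have -> : (N - uphalf N = uphalf N)%N by lia.
  by rewrite !big_nat1 hN eqxx.
have hN : (N <= uphalf N + uphalf N)%N by rewrite uphalfE; lia.
rewrite big_ltn; last by lia.
rewrite [in LHS]big_nat_recr /=; last by lia.
have -> : (N - (uphalf N + m.+1)).+1 = (N - (uphalf N + m))%N by lia.
rewrite addnS in le_rN *; rewrite IH; last by lia.
rewrite [in RHS]big_nat_recr /=; last by lia.
case: eqP => [|_]; first by lia.
by rewrite symE // addrCA -scalerDl; congr (_ + _ *: _); rewrite addrC.
Qed.

(** Elimination from the top: a multiple of [b h] absorbs the term in [E h], and induction handles
    the corrected lower coefficients. *)
Lemma triangular_span (F : fieldType) (V : lmodType F) (E b : nat -> V) (v : nat -> nat -> F)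
    (lo hi m : nat) (c : nat -> F) :
  (forall r, (lo <= r <= hi)%N -> b r = \sum_(lo <= i < r.+1) v r i *: E i) ->
  (forall r, (lo <= r <= hi)%N -> v r r != 0) -> (lo + m <= hi.+1)%N ->
  exists c' : nat -> F,
    \sum_(lo <= i < lo + m) c i *: E i = \sum_(lo <= r < lo + m) c' r *: b r.
Proof.
move=> bE v0; elim: m c => [|m IH] c le_m; first by exists c; rewrite addn0 !big_geq.
rewrite addnS in le_m *; set h := (lo + m)%N in le_m *.
have h_in : (lo <= h <= hi)%N by rewrite /h; lia.
pose a := c h / v h h.
have [|c' Ec'] := IH (fun i => c i - a * v h i); first by rewrite -/h; lia.
exists (fun r => if r == h then a else c' r).
have lo_h : (lo <= h)%N by case/andP: h_in.
rewrite !big_nat_recr //= eqxx [X in _ = X + _](eq_big_nat _ _ (F2 := fun r => c' r *: b r)).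
  rewrite -Ec' bE // big_nat_recr //= scalerDr scalerA divfK ?v0 // addrA; congr (_ + _).
  rewrite scaler_sumr -big_split; apply: eq_bigr => i _ /=.
  by rewrite scalerA -scalerDl subrK.
by move=> r r_in; case: eqP => // eq_rh; lia.
Qed.

(** Descending induction on [r]: in the coefficient of [mon r], smaller indices do not contribute
    and larger ones already have [c i = 0]. *)
Lemma triangular_free (R : idomainType) (n : nat) (b : nat -> {mpoly R[n]})
    (mon : nat -> 'X_{1..n}) (lo hi : nat) (c : nat -> R) :
  (forall r a, (lo <= r)%N -> (r < a <= hi)%N -> (b r)@_(mon a) = 0) ->
  (forall r, (lo <= r <= hi)%N -> (b r)@_(mon r) != 0) ->
  \sum_(lo <= r < hi.+1) c r *: b r = 0 -> forall r, (lo <= r <= hi)%N -> c r = 0.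
Proof.
move=> upper diag sum0 r; have [d] := ubnP (hi - r)%N.
elim: d r => // d IH r lt_d r_in; have := congr1 (mcoeff (mon r)) sum0.
rewrite raddf_sum /= mcoeff0 (big_cat_nat (n := r)) /=; [|lia..].
rewrite big_nat big1 => [|i i_r]; last by rewrite mcoeffZ upper ?mulr0 //; lia.
rewrite add0r big_ltn; last by lia.
rewrite big_nat big1 => [|i i_r]; last by rewrite IH ?scale0r ?mcoeff0 //; lia.
by rewrite addr0 mcoeffZ => /eqP; rewrite mulf_eq0 (negPf (diag _ r_in)) orbF => /eqP.
Qed.

(** * Quadratic monomials of the jet ring *)

Definition pair_mnm (n i j : nat) : 'X_{1..n.+2} := (U_(inord i.+1) + U_(inord j.+1))%MM.

Lemma uvar_pairE (R : realFieldType) (n i j : nat) :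
  uvar R n i * uvar R n j = 'X_[pair_mnm n i j].
Proof. by rewrite mpolyXD. Qed.

Lemma pair_mnmE (n i j a : nat) : (i <= n)%N -> (j <= n)%N -> (a <= n)%N ->
  pair_mnm n i j (inord a.+1) = ((i == a) + (j == a))%N.
Proof.
move=> le_in le_jn le_an; by rewrite mnmDE !mnm1E -!val_eqE /= !inordK.
Qed.

(** The bounds [N <= i + i] and [N <= a + a] select one representative of each pair [{i, N - i}], so
    distinct indices give distinct monomials. *)
Lemma mcoeff_uvar_pair (R : realFieldType) (n N i a : nat) :
  (N <= i + i)%N -> (N <= a + a)%N -> (i <= minn n N)%N -> (a <= minn n N)%N ->
  (uvar R n i * uvar R n (N - i))@_(pair_mnm n a (N - a)) = (i == a)%:R.
Proof.
move=> Ni Na le_i le_a; rewrite uvar_pairE mcoeffX; congr (nat_of_bool _)%:R.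
apply/eqP/eqP => [/(congr1 (fun m : 'X_{1..n.+2} => m (inord a.+1)))|-> //].
by rewrite !pair_mnmE; lia.
Qed.

Lemma in_Qk_sumE (V : nmodType) (n N : nat) (F : nat -> V) :
  \sum_(i < N.+1 | (i <= n)%N && (N - i <= n)%N) F i
  = \sum_(N - minn n N <= i < (minn n N).+1) F i.
Proof.
rewrite (big_nat_widenl _ 0) // (big_nat_widen _ _ N.+1); last by lia.
by rewrite big_mkord; apply: eq_bigl => -[i ltiN] /=; lia.
Qed.

(** The linear part is nonzero by parity for odd [N] and by size for even [N]. Both falling
    factorials start from naturals at least their length [n - r], because [N - r <= r]. *)
Lemma qcoefDrev_neq0 (R : realFieldType) (n N r : nat) :
  (r <= minn n N)%N -> (N <= r + r)%N ->
  qcoef R n N r r + qcoef R n N r (N - r) != 0.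
Proof.
move=> le_r le_Nr; rewrite qcoefDrev; last by lia.
rewrite !mulf_neq0 ?signr_eq0 ?invr_eq0 ?pnatr_eq0 //.
- by rewrite -lt0n muln_gt0 !fact_gt0.
- case: ifP => oddN; rewrite subr_eq0 -!mulrnA -?natrD eqr_nat; last by apply/eqP; lia.
  by apply: contraTneq oddN => <-; rewrite muln2 odd_double.
have e1 : r%:R + n%:R - N%:R + 0%:R = (n - (N - r))%:R :> R.
  by rewrite !natrB; [ring | lia..].
have e2 : n%:R - r%:R = (n - r)%:R :> R by rewrite natrB //; lia.
by rewrite horner_weight_poly e1 e2 addn0 mulf_neq0 ?fall_neq0 //; lia.
Qed.

(* The coefficient of [u_i u_(N-i)], for [N <= 2 i], once the two equal
   monomials of the defining sum are collected. *)
Definition qfold (R : realFieldType) (n N r i : nat) : R :=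
  if (i + i == N)%N then qcoef R n N r i else qcoef R n N r i + qcoef R n N r (N - i).

Lemma qfold_neq0 (R : realFieldType) (n N r : nat) :
  (r <= minn n N)%N -> (N <= r + r)%N -> qfold R n N r r != 0.
Proof.
move=> le_r le_Nr; have := qcoefDrev_neq0 R le_r le_Nr.
rewrite /qfold; case: (r + r =P N)%N => // rN; have -> : (N - r = r)%N by lia.
by apply: contraNN => /eqP->; rewrite addr0.
Qed.

(** * Membership, order, deficiency and basis *)

Lemma QkrE (R : realFieldType) (n N r : nat) :
  Qkr R n (N%:Z - n%:Z) r
  = \sum_(N - r <= i < r.+1) qcoef R n N r i *: (uvar R n i * uvar R n (N - i)).
Proof. by rewrite /Qkr addrC subrK. Qed.

Lemma Qkr_foldE (R : realFieldType) (n N r : nat) : (uphalf N <= r <= N)%N ->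
  Qkr R n (N%:Z - n%:Z) r
  = \sum_(uphalf N <= i < r.+1) qfold R n N r i *: (uvar R n i * uvar R n (N - i)).
Proof.
by move=> r_in; rewrite QkrE sum_fold_sym // => i le_iN; rewrite subKn // mulrC.
Qed.

Lemma mcoeff_Qkr (R : realFieldType) (n N r a : nat) :
  (uphalf N <= r <= minn n N)%N -> (uphalf N <= a <= minn n N)%N ->
  (Qkr R n (N%:Z - n%:Z) r)@_(pair_mnm n a (N - a))
  = if (a <= r)%N then qfold R n N r a else 0.
Proof.
move=> r_in a_in; have hN : (N <= uphalf N + uphalf N)%N by rewrite uphalfE; lia.
have coefE i : (uphalf N <= i < r.+1)%N ->
    (qfold R n N r i *: (uvar R n i * uvar R n (N - i)))@_(pair_mnm n a (N - a))
    = if i == a then qfold R n N r i else 0.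
  move=> i_in; rewrite mcoeffZ mcoeff_uvar_pair; [|lia..].
  by case: eqP; rewrite ?mulr1 ?mulr0.
rewrite Qkr_foldE; last by lia.
rewrite raddf_sum /= (eq_big_nat _ _ coefE) -big_mkcond /=.
rewrite big_nat1_eq.
by have -> : (uphalf N <= a < r.+1)%N = (a <= r)%N by lia.
Qed.

Lemma Qkr_in_Qk (R : realFieldType) (n N r : nat) : (r <= minn n N)%N ->
  in_Qk (N%:Z - n%:Z) (Qkr R n (N%:Z - n%:Z) r).
Proof.
move=> le_r; rewrite QkrE /in_Qk [n%:Z + _]addrC subrK /=.
exists (fun i => if (N - r <= i < r.+1)%N then qcoef R n N r i else 0).
rewrite (in_Qk_sumE n N (fun i => (if (N - r <= i < r.+1)%N then qcoef R n N r i else 0)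
  *: (uvar R n i * uvar R n (N - i)))).
transitivity (\sum_(N - r <= i < r.+1) (if (N - r <= i < r.+1)%N then qcoef R n N r i else 0)
  *: (uvar R n i * uvar R n (N - i))).
  by apply: eq_big_nat => i ->.
apply: eq_big_nat_support => i i_out; rewrite ifN ?scale0r //; lia.
Qed.

Lemma Qkr_has_order (R : realFieldType) (n N r : nat) :
  (uphalf N <= r <= minn n N)%N -> has_order (Qkr R n (N%:Z - n%:Z) r) r.
Proof.
move=> r_in; have hN : (N <= uphalf N + uphalf N)%N by rewrite uphalfE; lia.
split; first exists (pair_mnm n r (N - r)).
- by rewrite mcoeff_msupp mcoeff_Qkr // leqnn qfold_neq0 //; lia.
- by rewrite pair_mnmE ?eqxx //; lia.
move=> j j_in [m]; rewrite mcoeff_msupp => /eqP Qm m_gt0; case: Qm.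
(* Every term has both indices [i] and [N - i] at most [r], so none involves [u_j]. *)
rewrite QkrE raddf_sum /= big_nat big1 // => i i_in.
rewrite mcoeffZ uvar_pairE mcoeffX; case: eqP => [mE|_]; last by rewrite mulr0.
by move: m_gt0; rewrite -mE pair_mnmE; lia.
Qed.

Lemma Qkr_deficiency (R : realFieldType) (n N r : nat) :
  (uphalf N <= r <= minn n N)%N ->
  has_deficiency (Qkr R n (N%:Z - n%:Z) r)
    (N%:Z - n%:Z + 2%:Z * (r%:Z - (uphalf N)%:Z)).
Proof.
move=> r_in; have hN : (uphalf N + uphalf N = N + odd N)%N by rewrite uphalfE; lia.
have le_rN : (r <= N)%N by lia.
have [||| W [sW W0 W0' actW]] := @quad_form_qcoef R n N r; [lia..|].
have actE f : act (Qkr R n (N%:Z - n%:Z) r) f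
              = quad_form N r (fun i => (-1) ^+ i * W.[i%:R]) f f.
  by rewrite QkrE act_sum_uvar ?actW //; lia.
rewrite /has_deficiency /inPs; split=> [f sf|all_f].
  have := size_quad_form W0 W0' le_rN sf (eq_leq sW); rewrite -actE.
  by move: (size _) => size_f; lia.
(* The exponent [p = n - r + uphalf N] satisfies [p <= n], and [p + p - N] is exactly the degree of
   [W]. *)
have /all_f : (size ('X^(n - r + uphalf N) : {poly R}) <= n.+1)%N by rewrite size_polyXn; lia.
by rewrite actE (size_quad_form_Xn W0 W0' _ _ _ sW); lia.
Qed.

Lemma Qkr_basis (R : realFieldType) (n N : nat) : (N <= n + n)%N ->
  is_basis (@in_Qk R n (N%:Z - n%:Z)) (Qkr R n (N%:Z - n%:Z)) (uphalf N) (minn n N).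
Proof.
move=> le_N; have hN : (N <= uphalf N + uphalf N <= N.+1)%N by rewrite uphalfE; lia.
split=> [r r_in|c|P].
- by apply: Qkr_in_Qk; lia.
- apply: (triangular_free (mon := fun a => pair_mnm n a (N - a))) => [r a lo_r a_in|r r_in].
    by rewrite mcoeff_Qkr ?ifN //; lia.
  by rewrite mcoeff_Qkr // leqnn qfold_neq0 //; lia.
rewrite /in_Qk [n%:Z + _]addrC subrK /= => -[c ->].
rewrite (in_Qk_sumE n N (fun i => c i *: (uvar R n i * uvar R n (N - i)))).
rewrite sum_fold_sym; [|by move=> i le_iN; rewrite subKn // mulrC|lia].
have -> : (minn n N).+1 = (uphalf N + ((minn n N).+1 - uphalf N))%N by lia.
apply: (triangular_span (hi := minn n N) (v := qfold R n N)) => [r r_in|r r_in|].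
- by rewrite Qkr_foldE //; lia.
- by rewrite qfold_neq0 //; lia.
- by lia.
Qed.

Theorem mainTheorem1 (R : realFieldType) (n : nat) (k : int) :
  (1 <= n)%N -> - (n%:Z) <= k -> k <= n%:Z ->
  (forall r : nat, (rmin n k <= r <= rmax n k)%N ->
     [/\ Qkr R n k r != 0,
         @in_Qk R n k (Qkr R n k r),
         @has_order R n (Qkr R n k r) r
       & @has_deficiency R n (Qkr R n k r) (k + 2%:Z * (r%:Z - (rmin n k)%:Z))]) /\
  @is_basis R n (@in_Qk R n k) (Qkr R n k) (rmin n k) (rmax n k).
Proof.
move=> _ ge_k le_k; rewrite /rmin /rmax; set N := absz (n%:Z + k).
(* The bound [-n <= k] makes [n + k] nonnegative, so its absolute value [N] recovers [k]. *)
have -> : k = N%:Z - n%:Z by lia.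
split=> [r r_in|]; last by apply: Qkr_basis; lia.
have ord_r := @Qkr_has_order R n N r r_in; split=> //.
- case: ord_r => -[m m_in _] _; apply: contraTneq m_in => ->.
  by rewrite mcoeff_msupp mcoeff0 eqxx.
- by apply: Qkr_in_Qk; lia.
- exact: Qkr_deficiency.
Qed.
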